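(* Let $(X,d)$ be a nonempty metric space, and let $k\geq 2$ be an integer. The following are equivalent. (1) There exist nonempty metric spaces $(P_j,d_j)$ for $1\leq j\leq k$ such that $(X,d)$ is isometric (via a bijective isometry) to $P_1\times\cdots\times P_k$ with the max product metric $(p,q)\mapsto\max_{1\leq j\leq k}d_j(p_j,q_j)$. (2) There exist equivalence relations $E_1,\dots,E_k$ on $X$ such that: (a) the quotient distance $\bar d_{E_j}$ is a metric on $X/E_j$ for each $j$; (b) for every choice of classes $C_j\in X/E_j$, $1\leq j\leq k$, the intersection $\bigcap_{j=1}^kC_j$ consists of exactly one point; (c) for all $x,y\in X$, $d(x,y)=\max_{1\leq j\leq k}\bar d_{E_j}([x]_{E_j},[y]_{E_j})$.
   Context: For an equivalence relation $E$ on a metric space $(X,d)$, $[x]_E$ is the $E$-class of $x$, and $\bar d_E([x]_E,[y]_E):=\inf\{d(x',y'):x'\,E\,x,\ y'\,E\,y\}$ is the quotient distance on $X/E$. All metric spaces are nonempty. *)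

(* Defs.v *)
From HB Require Import structures.
From mathcomp Require Import all_boot all_order all_algebra generic_quotient.
From mathcomp Require Import all_classical all_reals topology.
Set Implicit Arguments.
Unset Strict Implicit.
Unset Printing Implicit Defensive.
Import Order.TTheory GRing.Theory Num.Theory.
Local Open Scope classical_set_scope.
Local Open Scope quotient_scope.
Local Open Scope ring_scope.

Definition is_metric (R : realType) (T : Type) (d : T -> T -> R) : Prop :=
  [/\ forall x y, 0 <= d x y,
      forall x y, d x y = 0 <-> x = y,
      forall x y, d x y = d y x &
      forall x y z, d x z <= d x y + d y z].

Definition isometric (R : realType) (X Y : metricType R) : Prop :=
  exists f : X -> Y, bijective f /\ forall x y, mdist (f x) (f y) = mdist x y.

(* An alias of [forall j, P j]: the library already puts the product topology
   on the bare function type. *)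
Definition max_prod (R : realType) (k : nat) (P : 'I_k -> metricType R) : Type :=
  forall j, P j.

(* The default value 0 of the iterated maximum is harmless, since distances are
   nonnegative. *)
Definition max_dist (R : realType) (k : nat) (P : 'I_k -> metricType R)
    (p q : max_prod P) : R :=
  \big[Num.max/0]_(j < k) mdist (p j) (q j).

Section MaxProd.
Context {R : realType} {k : nat} (P : 'I_k -> metricType R).

HB.instance Definition _ := gen_eqMixin (max_prod P).
HB.instance Definition _ := gen_choiceMixin (max_prod P).

Let max_distxx (p : max_prod P) : max_dist p p = 0.
Proof.
apply: (big_ind (fun z => z = 0)) => [//|_ _ -> ->|j _]; last exact: mdistxx.
by rewrite maxxx.
Qed.

Let le_max_dist (p q : max_prod P) j : mdist (p j) (q j) <= max_dist p q.
Proof. exact: le_bigmax. Qed.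

Let max_dist_positivity (p q : max_prod P) : max_dist p q = 0 -> p = q.
Proof.
move=> pq0; apply: functional_extensionality_dep => j.
apply: (@mdist_positivity R); apply/eqP; rewrite eq_le mdist_ge0 andbT.
by rewrite -pq0 le_max_dist.
Qed.

Let max_dist_sym (p q : max_prod P) : max_dist p q = max_dist q p.
Proof. by apply: eq_bigr => j _; rewrite metric_sym. Qed.

Let max_dist_triangle (q p r : max_prod P) :
  max_dist p r <= max_dist p q + max_dist q r.
Proof.
apply: bigmax_le => [|j _]; first by rewrite addr_ge0// bigmax_ge_id.
by rewrite (le_trans (metric_triangle _ (q j) _))// lerD.
Qed.

HB.instance Definition _ := @isMetric.Build R (max_prod P) (@max_dist R k P)
  max_distxx max_dist_positivity max_dist_sym max_dist_triangle.

End MaxProd.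

(* [equiv_rel X] consists of boolean relations; classically this is no
   restriction. *)
Definition eq_class (R : realType) (X : metricType R) (E : equiv_rel X)
    (C : {eq_quot E}) : set X :=
  [set x | \pi_{eq_quot E} x = C].

Definition quot_dist (R : realType) (X : metricType R) (E : equiv_rel X)
    (C D : {eq_quot E}) : R :=
  inf [set mdist x y | x in eq_class C & y in eq_class D].

(* Main.v *)
Require Import Defs.
From HB Require Import structures.
From mathcomp Require Import all_boot all_order all_algebra generic_quotient.
From mathcomp Require Import all_classical all_reals topology.
Set Implicit Arguments.
Unset Strict Implicit.
Unset Printing Implicit Defensive.
Import Order.TTheory GRing.Theory Num.Theory.
Local Open Scope classical_set_scope.
Local Open Scope quotient_scope.
Local Open Scope ring_scope.

(** In a max product, each factor is recovered from the product as a quotient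
    metric.  Two fibres of the [j]-th coordinate, over [a] and [b], are at
    distance at least [d_j a b], since no coordinate distance exceeds the
    maximum; and the bound is attained from every point [p] of the first fibre,
    by changing the [j]-th coordinate of [p] to [b] and nothing else
    ([mdist_dfwith]).  So for [x E_j y := (f x) j = (f y) j], where [f] is an
    isometry onto the product, the quotient distance on [X / E_j] is the
    distance of the [j]-th factor ([quot_dist_coord]), which gives (a) and (c);
    a choice of one class for each [j] is a choice of coordinates, that is, a
    point of the product, which gives (b).

    Conversely, the quotients [X / E_j] with their quotient distances are the
    factors: the map sending a point to its tuple of classes is bijective by
    (b) and isometric by (c). *)

Lemma inf_min (R : realType) (A : set R) (m : R) : A m -> lbound A m -> inf A = m.
Proof.
move=> Am mA; apply/eqP; rewrite eq_le; apply/andP; split.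
  by apply: ge_inf => //; exists m.
by apply: lb_le_inf => //; exists m.
Qed.

(** * Metric spaces from distance functions *)

(** A copy of [T], indexed by the proof that [d] is a metric, so that the metric
    structure given by [d] does not compete with one that [T] already has. *)
Definition metrized (R : realType) (T : Type) (d : T -> T -> R)
  (d_metric : is_metric d) : Type := T.

Section Metrized.
Context {R : realType} {T : Type} {d : T -> T -> R} (d_metric : is_metric d).

HB.instance Definition _ := gen_eqMixin (metrized d_metric).
HB.instance Definition _ := gen_choiceMixin (metrized d_metric).

Let dxx x : d x x = 0.
Proof. by have [_ d0 _ _] := d_metric; apply/d0. Qed.

Let d_positivity x y : d x y = 0 -> x = y.
Proof. by have [_ d0 _ _] := d_metric; move/d0. Qed.

Let d_sym x y : d x y = d y x.
Proof. by have [_ _ + _] := d_metric; apply. Qed.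

Let d_triangle y x z : d x z <= d x y + d y z.
Proof. by have [_ _ _ +] := d_metric; apply. Qed.

HB.instance Definition _ := @isMetric.Build R (metrized d_metric) d
  dxx d_positivity d_sym d_triangle.

End Metrized.

Lemma is_metric_transport (R : realType) (T : Type) (M : metricType R)
    (d : T -> T -> R) (h : T -> M) :
  injective h -> (forall x y, d x y = mdist (h x) (h y)) -> is_metric d.
Proof.
move=> h_inj dE; split=> [x y|x y|x y|x y z]; rewrite !dE.
- exact: mdist_ge0.
- by split=> [/mdist_positivity/h_inj|->]; last exact: mdistxx.
- exact: metric_sym.
- exact: metric_triangle.
Qed.

(** * The kernel of a map as an equivalence relation *)

Section Ker.
Context {T : choiceType} {U : Type} (h : T -> U).

Definition ker_rel (x y : T) : bool := `[< h x = h y >].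

Let ker_refl : reflexive ker_rel.
Proof. by move=> x; apply/asboolP. Qed.

Let ker_sym : symmetric ker_rel.
Proof. by move=> x y; apply/asboolP/asboolP. Qed.

Let ker_trans : transitive ker_rel.
Proof. by move=> y x z /asboolP xy /asboolP yz; apply/asboolP; rewrite xy. Qed.

Definition ker_equiv : equiv_rel T := EquivRel ker_rel ker_refl ker_sym ker_trans.

Lemma pi_kerP x y :
  \pi_{eq_quot ker_equiv} x = \pi_{eq_quot ker_equiv} y <-> h x = h y.
Proof. by split=> [/eqmodP/asboolP|hxy]; last exact/eqmodP/asboolP. Qed.

Definition ker_value (C : {eq_quot ker_equiv}) : U := h (repr C).

Lemma ker_value_pi x : ker_value (\pi x) = h x.
Proof. by apply/pi_kerP; rewrite reprK. Qed.

Lemma ker_value_inj : injective ker_value.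
Proof. by move=> C D /pi_kerP; rewrite !reprK. Qed.

End Ker.

(** * From a product decomposition to equivalence relations *)

Lemma mdist_coord_le (R : realType) (k : nat) (P : 'I_k -> metricType R)
  (p q : max_prod P) j : mdist (p j) (q j) <= mdist p q.
Proof. exact: (le_bigmax _ (fun i => mdist (p i) (q i))). Qed.

Lemma mdist_dfwith (R : realType) (k : nat) (P : 'I_k -> metricType R)
    (p : max_prod P) j (a : P j) :
  mdist p (dfwith p j a : max_prod P) = mdist (p j) a.
Proof.
apply/eqP; rewrite eq_le; apply/andP; split; last first.
  by rewrite -[in leLHS](dfwithin p a); exact: (mdist_coord_le p (dfwith p j a)).
apply: bigmax_le => [|i _]; first exact: mdist_ge0.
by case: dfwithP => [//|i' _]; rewrite mdistxx mdist_ge0.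
Qed.

Section ProductToRelations.
Context {R : realType} {X : metricType R} {k : nat} {P : 'I_k -> metricType R}.
Variable f : X -> max_prod P.
Hypothesis f_bij : bijective f.
Hypothesis f_isom : forall x y, mdist (f x) (f y) = mdist x y.

Let E j := ker_equiv (fun x => f x j).

(** The infimum is a minimum: from any point of the first class, changing one
    coordinate reaches the second class at the distance of the values. *)
Lemma quot_dist_coord j (C D : {eq_quot (E j)}) :
  quot_dist C D = mdist (ker_value C) (ker_value D).
Proof.
have [g fK gK] := f_bij; apply: inf_min.
- exists (repr C); first exact: reprK.
  exists (g (dfwith (f (repr C)) j (ker_value D))).
    by rewrite /eq_class /= -[RHS]reprK; apply/pi_kerP; rewrite gK dfwithin.
  by rewrite -f_isom gK mdist_dfwith.
- move=> _ [x <- [y <- <-]]; rewrite !ker_value_pi -f_isom.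
  exact: mdist_coord_le.
Qed.

Lemma quot_dist_coord_is_metric j : is_metric (@quot_dist R X (E j)).
Proof. exact: is_metric_transport (@ker_value_inj _ _ _) (@quot_dist_coord j). Qed.

Lemma coord_classes_meet_once (C : forall j, {eq_quot (E j)}) :
  exists! x : X, (\bigcap_(j in [set: 'I_k]) eq_class (C j)) x.
Proof.
have [g fK gK] := f_bij.
pose p : max_prod P := fun j => ker_value (C j).
exists (g p); split=> [j _|y yC].
  by rewrite /eq_class /= -[RHS]reprK; apply/pi_kerP; rewrite gK.
rewrite -[RHS]fK; congr (g _); apply: functional_extensionality_dep => j.
by rewrite /p -(yC j I) ker_value_pi.
Qed.

Lemma mdist_max_quot_dist x y :
  mdist x y = \big[Num.max/0]_(j < k) quot_dist (\pi_{eq_quot (E j)} x)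
                                                (\pi_{eq_quot (E j)} y).
Proof.
rewrite -f_isom; apply: eq_bigr => j _.
by rewrite quot_dist_coord !ker_value_pi.
Qed.

End ProductToRelations.

(** * From equivalence relations to a product decomposition *)

Section RelationsToProduct.
Context {R : realType} {X : metricType R} {k : nat}.
Variable E : 'I_k -> equiv_rel X.
Hypothesis E_metric : forall j, is_metric (@quot_dist R X (E j)).
Hypothesis E_meet : forall C : (forall j, {eq_quot (E j)}),
  exists! x : X, (\bigcap_(j in [set: 'I_k]) eq_class (C j)) x.
Hypothesis E_dist : forall x y : X,
  mdist x y = \big[Num.max/0]_(j < k) quot_dist (\pi_{eq_quot (E j)} x)
                                                (\pi_{eq_quot (E j)} y).

Definition quot_space j : metricType R := metrized (E_metric j).

Definition classes (x : X) : max_prod quot_space := fun j => \pi_{eq_quot (E j)} x.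

Lemma classes_bij : bijective classes.
Proof.
have /choice[g gP] := E_meet.
have gK : cancel g classes.
  move=> C; apply: functional_extensionality_dep => j.
  by have [+ _] := gP C; apply.
exists g => // x; have [_] := gP (classes x); apply.
by move=> j _.
Qed.

Lemma classes_isom : isometric X (max_prod quot_space).
Proof.
exists classes; split=> [|x y]; first exact: classes_bij.
by rewrite [RHS]E_dist.
Qed.

End RelationsToProduct.

Theorem theorem3p13 (R : realType) (X : metricType R) (X0 : [set: X] !=set0)
    (k : nat) (hk : (2 <= k)%N) :
  (exists P : 'I_k -> metricType R,
     (forall j, [set: P j] !=set0) /\ isometric X (max_prod P))
  <->
  (exists E : 'I_k -> equiv_rel X,
     [/\ forall j, is_metric (@quot_dist R X (E j)),
         forall C : (forall j, {eq_quot (E j)}),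
           exists! x : X, (\bigcap_(j in [set: 'I_k]) eq_class (C j)) x &
         forall x y : X,
           mdist x y =
           \big[Num.max/0]_(j < k) quot_dist (\pi_{eq_quot (E j)} x)
                                             (\pi_{eq_quot (E j)} y)]).
Proof.
split=> [[P [_ [f [f_bij f_isom]]]]|[E [E_metric E_meet E_dist]]].
- exists (fun j => ker_equiv (fun x => f x j)); split.
  + by move=> j; exact: quot_dist_coord_is_metric.
  + exact: coord_classes_meet_once.
  + exact: mdist_max_quot_dist.
- exists (quot_space E_metric); split; last exact: classes_isom.
  by move=> j; have [x _] := X0; exists (classes E_metric x j).
Qed.
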